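(* Let $m\ge 1$ and $n\ge 1$ be integers, let $A\in\mathbb{R}^{n\times n}$ and $C_i\in\mathbb{R}^{s_i\times n}$, $i\in\{1,\dots,m\}$, and consider the $m$-channel system $$\dot x = Ax,\qquad y_i = C_i x,\quad i\in\{1,\dots,m\},\qquad x\in\mathbb{R}^n.$$ Assume that $C_i\neq 0$ for every $i$, that the system is jointly observable (i.e. with $C=\begin{bmatrix}C_1^\top & \cdots & C_m^\top\end{bmatrix}^\top$ the pair $(C,A)$ is observable), and that the neighbor graph $\mathbb{N}$ is strongly connected. Then for every set $\Lambda$ of $mn+m-1$ complex numbers (counted with multiplicity) that is symmetric, i.e. closed under complex conjugation, there exists a distributed observer $$\dot z_i=\sum_{j\in\mathcal{N}_i}\big(H_{ij}z_j+K_{ij}y_j\big),\qquad x_i=\sum_{j\in\mathcal{N}_i}\big(M_{ij}z_j+N_{ij}y_j\big),\qquad i\in\{1,\dots,m\},$$ with $z_i\in\mathbb{R}^{n_i}$ and $\sum_i n_i=mn+m-1$, such that the spectrum of the $(mn+m-1)\times(mn+m-1)$ block matrix $H=[H_{ij}]$ (with $H_{ij}=0$ whenever $j\notin\mathcal{N}_i$) is exactly $\Lambda$. Moreover, for every initialization of $x$ and of the $z_i$, each estimation error $e_i(t)=x_i(t)-x(t)$, $i\in\{1,\dots,m\}$, converges to zero as $t\to\infty$ as fast as $e^{Ht}$ converges to zero (i.e. there is a constant $c$, depending on the initialization, with $\|e_i(t)\|\le c\,\|e^{Ht}\|$ for all $t\ge 0$).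
   Context: There are $m$ agents labeled $1,\dots,m$. For each $i$, $\mathcal{N}_i\subseteq\{1,\dots,m\}$ is the set of neighbors of agent $i$, and $i\in\mathcal{N}_i$. The neighbor graph $\mathbb{N}$ is the directed graph on vertices $\{1,\dots,m\}$ with an arc from $j$ to $i$ whenever $j\in\mathcal{N}_i$ and $j\neq i$. Agent $i$ measures $y_i$ and receives $z_j$ and $y_j$ from each neighbor $j\in\mathcal{N}_i$. The matrices $H_{ij},K_{ij},M_{ij},N_{ij}$ are constant real matrices of compatible dimensions. *)

(* Defs.v *)
From HB Require Import structures.
From mathcomp Require Import all_boot all_order all_algebra.
From mathcomp Require Import all_classical all_reals all_analysis.
From mathcomp Require Import matrix_normedtype.
From mathcomp.real_closed Require Import complex.
Import numFieldNormedType.Exports.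
Set Implicit Arguments. Unset Strict Implicit. Unset Printing Implicit Defensive.
Import Order.TTheory GRing.Theory Num.Theory.
Local Open Scope ring_scope.

Section Defs.
Variable R : realType.

Definition obs_matrix (n q : nat) (C : 'M[R]_(q, n)) (A : 'M[R]_n) :=
  \mxcol_(k < n) (C *m A ^+ k).

Definition observable (n q : nat) (C : 'M[R]_(q, n)) (A : 'M[R]_n) : Prop :=
  \rank (obs_matrix C A) = n.

Definition expmx (p : nat) (H : 'M[R]_p) (t : R) : 'M[R]_p :=
  limn (series (fun k : nat => (t ^+ k / (k`!)%:R) *: H ^+ k)).

Definition spectrum_eq (p : nat) (H : 'M[R]_p) (L : seq R[i]) : Prop :=
  char_poly (map_mx (real_complex R) H) = \prod_(l <- L) ('X - l%:P).

Definition conj_symmetric (L : seq R[i]) : Prop := perm_eq (map conjc L) L.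
End Defs.

Definition neighbor_rel (m : nat) (Nb : 'I_m -> {set 'I_m}) : rel 'I_m :=
  fun j i => (j \in Nb i) && (j != i).

Definition strongly_connected (m : nat) (Nb : 'I_m -> {set 'I_m}) : Prop :=
  forall i j : 'I_m, connect (neighbor_rel Nb) i j.

(* Main.v *)
(* The observer is a cascade of blocks z' = F z + ..., where z tracks a vector of
   functionals L x and L A - F L lies in the span of functionals already
   available to the agent owning z, from its neighbours or from its own output.
   The spectrum of H is then the union of those of the blocks, and every F can
   be a companion matrix with prescribed characteristic polynomial.

   Information is first gathered along an in-tree to a root agent: an agent that
   has received an A-invariant space U of functionals and measures a row c
   extends U by the Krylov space of c.  As c itself is measured, one dimension
   may be left out of such a block, so that its dimension can be taken even.
   Once the root knows x, it is broadcast along an out-tree; the block completing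
   the knowledge of an agent relays known functionals, so its dimension can be
   increased to make the agent's total the even number among n, n + 1.
   Even dimensions are what lets an arbitrary real polynomial be split among the
   blocks, and the total is at most (m - 1)(n + 1) + n = mn + m - 1; the excess
   is filled by a block tracking L = 0.

   The errors e = z - L x satisfy e' = H e, whence e(t) = exp(tH) e(0) by
   estimating Taylor remainders. *)
Require Import Defs.
From HB Require Import structures.
From mathcomp Require Import all_boot all_order all_algebra.
From mathcomp Require Import all_classical all_reals all_analysis.
From mathcomp Require Import matrix_normedtype.
From mathcomp.real_closed Require Import complex.
From mathcomp Require Import perm ring.
Import numFieldNormedType.Exports.
Import Order.TTheory GRing.Theory Num.Theory.
Local Open Scope ring_scope.
Set Implicit Arguments. Unset Strict Implicit. Unset Printing Implicit Defensive.

(** * Krylov spaces *)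

Section Subspaces.
Variable F : fieldType.

Lemma rank_adds_row n (Y : 'M[F]_n) (v : 'rV_n) :
  ~~ (v <= Y)%MS -> (\rank Y < \rank (Y + v)%MS)%N.
Proof.
move=> vY; rewrite ltnNge; apply: contra vY => le.
have /eqmxP eqY : (Y == Y + v)%MS.
  by rewrite -(geq_leqif (mxrank_leqif_eq (addsmxSl Y v))).
by rewrite eqY addsmxSr.
Qed.

(** Greedy choice, one row at a time: while [V0] is not inside [Y], a row of [l] lying in [Y] is
    pushed out of it by adding a row of [V0], so each treated row enlarges [Y] by one dimension. The
    rank bound ensures that [V0] is absorbed before the rows run out. *)
Lemma perturb_rows_span n d (Y V0 : 'M[F]_n) (l : 'M[F]_(d, n)) :
  (\rank (Y + V0 + l)%MS <= \rank Y + d)%N ->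
  exists2 S : 'M[F]_(d, n), (S <= V0)%MS & (Y + V0 + l <= Y + (l + S)%R)%MS.
Proof.
elim: d Y l => [|d IHd] Y; last rewrite -[d.+1]add1n; move=> l rk.
  exists 0; rewrite ?sub0mx // addr0 addsmxS //.
  rewrite -(geq_leqif (mxrank_leqif_sup (addsmxSl Y V0))).
  by rewrite addn0 in rk; apply: leq_trans rk; apply/mxrankS/addsmxSl.
have [sV0Y|] := boolP (V0 <= Y)%MS.
  exists 0; rewrite ?sub0mx // addr0 !addsmx_sub addsmxSl addsmxSr.
  by rewrite (submx_trans sV0Y) ?addsmxSl.
case/row_subPn => k vY.
pose l1 := usubmx l; pose l2 := dsubmx l.
have [s1 [s1V0 l1s1]] : exists s1 : 'rV_n, (s1 <= V0)%MS /\ ~~ ((l1 + s1)%R <= Y)%MS.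
  have [l1Y|l1Y] := boolP (l1 <= Y)%MS; last by exists 0; rewrite addr0 sub0mx.
  exists (row k V0); split; first exact: row_sub.
  apply: contra vY => lv; have := addmx_sub lv (_ : - l1 <= Y)%MS.
  by rewrite addrC addKr eqmx_opp; apply.
pose Y' := (Y + (l1 + s1)%R)%MS.
have lE : (l :=: l1 + l2)%MS.
  apply: eqmx_sym; apply: eqmx_trans (addsmxE _ _) _.
  by rewrite (vsubmxK l).
have sub1 : (Y + V0 + l <= Y' + V0 + l2)%MS.
  rewrite !addsmx_sub lE !addsmx_sub.
  rewrite [(l2 <= _)%MS]addsmxSr.
  rewrite [(V0 <= _)%MS](submx_trans (addsmxSr Y' V0)) ?addsmxSl //.
  rewrite [(Y <= _)%MS](submx_trans (addsmxSl _ (l1 + s1)%R)) /=; last first.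
    by rewrite (submx_trans (addsmxSl _ V0)) ?addsmxSl.
  rewrite andbT -[l1](addrK s1) addmx_sub ?eqmx_opp //.
    by rewrite (submx_trans (addsmxSr Y _)) // (submx_trans (addsmxSl _ V0)) ?addsmxSl.
  by rewrite (submx_trans s1V0) // (submx_trans (addsmxSr Y' _)) ?addsmxSl.
have sub2 : (Y' + V0 + l2 <= Y + V0 + l)%MS.
  have YS : (Y <= Y + V0 + l)%MS by rewrite (submx_trans (addsmxSl _ V0)) ?addsmxSl.
  have VS : (V0 <= Y + V0 + l)%MS by rewrite (submx_trans (addsmxSr Y _)) ?addsmxSl.
  have lS : (l <= Y + V0 + l)%MS by rewrite addsmxSr.
  move: (lS); rewrite {1}lE addsmx_sub => /andP[l1S l2S].
  by rewrite !addsmx_sub YS VS l2S !andbT addmx_sub // (submx_trans s1V0).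
have [|S2 S2V0 S2P] := IHd Y' l2.
  apply: leq_trans (mxrankS sub2) (leq_trans rk _).
  by rewrite addnA addn1 leq_add2r rank_adds_row.
have sS : (col_mx s1 S2 <= V0)%MS by rewrite col_mx_sub s1V0.
exists (col_mx s1 S2); first exact: sS.
apply: submx_trans sub1 (submx_trans S2P _).
rewrite -[l](vsubmxK l) add_col_mx -/l1 -/l2.
have colS : ((l1 + s1)%R + (l2 + S2)%R <= Y + col_mx (l1 + s1) (l2 + S2))%MS.
  by rewrite addsmxE addsmxSr.
move: colS; rewrite addsmx_sub => /andP[c1 c2].
by rewrite !addsmx_sub addsmxSl c1 c2.
Qed.

Variable n : nat.
Variable A : 'M[F]_n.

Definition krylov (V : 'M[F]_n) (c : 'rV_n) k : 'M[F]_n :=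
  (V + \sum_(j < k) <<c *m A ^+ j>>)%MS.

Lemma krylov0 V c : (krylov V c 0 :=: V)%MS.
Proof. by rewrite /krylov big_ord0; exact: addsmx0. Qed.

Lemma krylovS V c k : (krylov V c k.+1 :=: krylov V c k + c *m A ^+ k)%MS.
Proof.
rewrite /krylov big_ord_recr /= addsmxA.
exact: adds_eqmx (eqmx_refl _) (genmxE _).
Qed.

Lemma krylov_sup V c k j : (j < k)%N -> (c *m A ^+ j <= krylov V c k)%MS.
Proof.
move=> jk; apply: submx_trans (addsmxSr _ _).
by rewrite (sumsmx_sup (Ordinal jk)) //= genmxE.
Qed.

Lemma sub_krylov V c : (c <= krylov V c n)%MS.
Proof.
have [n0|n0] := posnP n; last by have := krylov_sup V c n0; rewrite expr0 mulmx1.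
by rewrite (_ : c = 0) ?sub0mx //; apply/rowP => -[j lt]; exfalso; rewrite n0 in lt.
Qed.

Lemma krylovMr V c k : (V *m A <= V)%MS ->
  (krylov V c k *m A <= krylov V c k.+1)%MS.
Proof.
move=> VA; rewrite /krylov addsmxMr addsmx_sub (submx_trans VA) ?addsmxSl //=.
rewrite sumsmxMr; apply/sumsmx_subP => j _.
rewrite (eqmxMr _ (genmxE _)) -mulmxA mulmxE -exprSr.
by apply: krylov_sup; rewrite ltnS.
Qed.

(** Each new power of [A] either adds a dimension or falls into the span of its predecessors, and
    since [V] is invariant the latter persists for all higher powers. *)
Lemma krylov_dichotomy V c k : (V *m A <= V)%MS ->
  (c *m A ^+ k <= krylov V c k)%MS \/ (\rank V + k < \rank (krylov V c k.+1))%N.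
Proof.
move=> VA; elim: k => [|k [IH|IH]].
- have [?|cV] := boolP (c *m A ^+ 0 <= krylov V c 0)%MS; [by left | right].
  by rewrite krylovS addn0 -(krylov0 V c) rank_adds_row.
- left; rewrite exprSr -mulmxE mulmxA.
  by apply: submx_trans (submxMr _ IH) (krylovMr _ _ VA).
have [?|cV] := boolP (c *m A ^+ k.+1 <= krylov V c k.+1)%MS; [by left | right].
by rewrite (krylovS V c k.+1) addnS; apply: leq_ltn_trans IH (rank_adds_row cV).
Qed.

Lemma krylov_in V c : (V *m A <= V)%MS -> (c *m A ^+ n <= krylov V c n)%MS.
Proof.
move=> VA; case: (krylov_dichotomy c n VA) => // rk.
have := leq_trans rk (rank_leq_col _).
by rewrite ltnNge leq_addl.
Qed.

Lemma krylov_stable V c : (V *m A <= V)%MS -> (krylov V c n *m A <= krylov V c n)%MS.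
Proof.
move=> VA; apply: submx_trans (krylovMr c n VA) _.
by rewrite krylovS addsmx_sub submx_refl krylov_in.
Qed.

Lemma krylov_min V c k (S : 'M[F]_n) : (V <= S)%MS -> (c <= S)%MS ->
  (S *m A <= S)%MS -> (krylov V c k <= S)%MS.
Proof.
move=> VS cS SA; rewrite /krylov addsmx_sub VS /=; apply/sumsmx_subP => j _.
rewrite genmxE; elim: (j : nat) => [|{}j IH]; first by rewrite expr0 mulmx1.
by rewrite exprSr -mulmxE mulmxA; apply: submx_trans (submxMr _ IH) SA.
Qed.

(** This yields a monic polynomial of degree exactly [d] annihilating [c] modulo [V], for every
    bound [d] on the dimension added by [c] and not only the least one. *)
Lemma krylov_annihilate V c d : (V *m A <= V)%MS ->
  (\rank (krylov V c n) <= \rank V + d)%N -> (c *m A ^+ d <= krylov V c d)%MS.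
Proof.
move=> VA rk; case: (krylov_dichotomy c d VA) => // lt.
suff /mxrankS : (krylov V c d.+1 <= krylov V c n)%MS.
  by move=> /(leq_trans lt) /leq_trans /(_ rk); rewrite ltnn.
apply: krylov_min (krylov_stable c VA); first exact: addsmxSl.
exact: sub_krylov.
Qed.
End Subspaces.

(** * Observer blocks with prescribed characteristic polynomial *)

Section ObserverBlock.
Variables (F : fieldType) (n' : nat).
Local Notation n := n'.+1.
Variable A : 'M[F]_n.

Lemma krylov_polyP V c k v : (v <= krylov A V c k)%MS ->
  exists2 q : {poly F}, (size q <= k)%N & (v - c *m horner_mx A q <= V)%MS.
Proof.
elim: k v => [|k IHk] v.
  by rewrite krylov0; exists 0; rewrite ?size_poly0 // rmorph0 mulmx0 subr0.
rewrite krylovS => /sub_addsmxP[[u1 u2] /= ->].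
have [q szq qP] := IHk _ (submxMl u1 (krylov A V c k)).
exists (q + (u2 0 0) *: 'X^k).
  rewrite (leq_trans (size_polyD _ _)) // geq_max (leq_trans szq) //=.
  by rewrite (leq_trans (size_scale_leq _ _)) ?size_polyXn.
rewrite rmorphD /= linearZ /= rmorphXn /= horner_mx_X mulmxDr -scalemxAr.
by rewrite {1}[u2]mx11_scalar mul_scalar_mx opprD addrACA subrr addr0.
Qed.

Lemma size_monic_sub (p q : {poly F}) k : p \is monic -> q \is monic ->
  size p = k.+1 -> size q = k.+1 -> (size (p - q)%R <= k)%N.
Proof.
move=> /monicP mp /monicP mq sp sq; apply/leq_sizeP => j.
rewrite leq_eqVlt => /predU1P[<-|lt]; rewrite coefB.
  by move: mp mq; rewrite !lead_coefE sp sq /= => -> ->; rewrite subrr.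
by rewrite !nth_default ?subrr // ?sp ?sq.
Qed.

Lemma mulX_divp (p r : {poly F}) : p \is monic ->
  exists b, ('X * r) %/ p = 'X * (r %/ p) + b%:P.
Proof.
move=> mp; have p0 := monic_neq0 mp.
exists ((('X * (r %% p)) %/ p)`_0).
rewrite {1}(divp_eq r p) mulrDr mulrA divpD mulpK //; congr (_ + _).
apply: size1_polyC; rewrite size_divp // leq_subLR.
have [->|rp0] := eqVneq (r %% p) 0; first by rewrite mulr0 size_poly0.
rewrite mulrC size_mulX // addn1 prednK ?size_poly_gt0 //.
by rewrite ltn_modp.
Qed.

(** The rows are [c] times polynomials in [A] of degrees 1 to [d]; multiplication by [A] shifts them
    up to multiples of [c], and the companion matrix closes the chain modulo [V0]. Degree 0 is [c]
    itself, which is why [d] rows can serve [d.+1] new dimensions. *)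
Lemma observer_rows_krylov (p : {poly F}) (V0 : 'M[F]_n) (c : 'rV_n) (d := (size p).-1) :
    p \is monic -> (V0 *m A <= V0)%MS ->
    (\rank (krylov A V0 c n) <= \rank V0 + d.+1)%N ->
  exists l : 'M[F]_(d, n),
    [/\ (l *m A - companionmx p *m l <= V0 + c)%MS,
        (l <= krylov A V0 c n)%MS & (krylov A V0 c n <= V0 + c + l)%MS].
Proof.
move=> mp V0A rk; set K := krylov A V0 c n.
have sp : size p = d.+1 by rewrite prednK // size_poly_gt0 monic_neq0.
have [q szq qP] := krylov_polyP (krylov_annihilate V0A rk).
(* [r] annihilates [c] modulo [V0]. Its degree is one above that of [p], so [Q j] below has degree j
   + 1. *)
pose r := 'X^(d.+1) - q.
have mr : r \is monic.
  by rewrite monicE lead_coefDl ?size_polyN ?size_polyXn // lead_coefXn.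
have szr : size r = d.+2 by rewrite size_polyDl ?size_polyN ?size_polyXn.
pose ev (s : {poly F}) := c *m horner_mx A s.
have evr : (ev r <= V0)%MS.
  by rewrite /ev rmorphB /= rmorphXn /= horner_mx_X mulmxBr.
have evD s t : ev (s + t) = ev s + ev t by rewrite /ev rmorphD mulmxDr.
have evZ a s : ev (a *: s) = a *: ev s by rewrite /ev linearZ /= scalemxAr.
have evC b : ev b%:P = b *: c by rewrite /ev horner_mx_C mul_mx_scalar.
have evX s : ev ('X * s) = ev s *m A.
  by rewrite /ev mulrC rmorphM /= horner_mx_X -mulmxA.
pose Q j := ('X^j * r) %/ p.
(* [Q j] is the polynomial part of X^j r / p, so that the Horner scheme of [p]
   applied to the [Q j] telescopes to [r]. *)
have QS j : exists b, ev (Q j) *m A = ev (Q j.+1) + b *: c.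
  have [b] := mulX_divp ('X^j * r) mp; rewrite mulrA -exprS -/(Q _) -/(Q _) => QE.
  by exists (- b); rewrite QE -evX evD evC scaleNr addrK.
have Qr : ev (Q d) + \sum_(j < d) p`_j *: ev (Q j) = ev r.
  have -> : r = \sum_(j < d.+1) p`_j *: Q j.
    have pE : p = \sum_(j < d.+1) p`_j *: 'X^j by rewrite -sp -poly_def coefK.
    transitivity ((p * r) %/ p); first by rewrite mulKp ?monic_neq0.
    rewrite {1}pE mulr_suml.
    rewrite (big_morph (fun s : {poly F} => s %/ p) (divpD p) (div0p p)).
    apply: eq_bigr => j _.
    by rewrite -scalerAl divpZl.
  rewrite big_ord_recr /= evD addrC.
  have -> : p`_d = 1 by move/monicP: mp; rewrite lead_coefE.
  rewrite scale1r; congr (_ + _).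
  elim/big_rec2: _ => [|j s t _ ->]; first by rewrite /ev rmorph0 mulmx0.
  by rewrite evD evZ.
have evK s : (ev s <= K)%MS.
  elim/poly_ind: s => [|s b IH]; first by rewrite /ev rmorph0 mulmx0 sub0mx.
  rewrite mulrC evD evX evC addmx_sub ?scalemx_sub ?sub_krylov //.
  exact: submx_trans (submxMr _ IH) (krylov_stable c V0A).
pose l := \matrix_(j < d) ev (Q j).
have Fl j : row j (companionmx p *m l) =
    ev (Q j.+1) - (j.+1 == d)%:R *: ev r.
  rewrite row_mul mulmx_sum_row.
  have [jd|jd] := eqVneq j.+1 d.
    rewrite scale1r -Qr jd opprD addNKr -sumrN; apply: eq_bigr => k _.
    rewrite !mxE rowK (_ : ((j : nat) == _) = true) ?scaleNr //.
    by apply/eqP; move/(congr1 predn): jd.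
  have lt : (j.+1 < d)%N by rewrite ltn_neqAle jd ltn_ord.
  have jd' : (j : nat) != (size p).-2.
    apply: contra jd => /eqP e; apply/eqP.
    by rewrite [in LHS]e prednK //; exact: leq_trans lt.
  rewrite scale0r subr0 (bigD1 (Ordinal lt)) //= big1 => [|k kj].
    by rewrite rowK !mxE addr0 /= eqxx (negbTE jd') scale1r.
  rewrite !mxE (negbTE jd').
  have /negbTE -> : j.+1 != k.
    by apply: contra kj => /eqP e; apply/eqP/val_inj; rewrite /= e.
  by rewrite scale0r.
have lF : (l *m A - companionmx p *m l <= V0 + c)%MS.
  apply/row_subP => j; rewrite linearB /= Fl row_mul rowK.
  have [b ->] := QS j; rewrite opprB addrC subrKA.
  rewrite addmx_sub //; last by rewrite (submx_trans _ (addsmxSr V0 c)) ?scalemx_sub.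
  by rewrite (submx_trans _ (addsmxSl V0 c)) ?scalemx_sub.
exists l; split=> //; first by apply/row_subP => j; rewrite rowK evK.
apply: krylov_min.
- by rewrite (submx_trans _ (addsmxSl _ _)) ?addsmxSl.
- by rewrite (submx_trans _ (addsmxSl _ _)) ?addsmxSr.
rewrite addsmxMr addsmx_sub; apply/andP; split; last first.
  rewrite -[l *m A](subrK (companionmx p *m l)) addmx_sub //.
    exact: submx_trans lF (addsmxSl _ _).
  exact: submx_trans (submxMl _ _) (addsmxSr _ _).
rewrite addsmxMr addsmx_sub; apply/andP; split.
  by rewrite (submx_trans V0A) // (submx_trans _ (addsmxSl _ _)) ?addsmxSl.
(* It remains to place [c *m A]: as [Q 0] is monic of degree 1, it is [ev (Q 0)], the first row of
   [l], up to a multiple of [c]. *)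
have [b Q0] : exists b, Q 0%N = 'X + b%:P.
  exists (((r - p * 'X) %/ p)`_0); rewrite /Q expr0 mul1r.
  rewrite -{1}(subrK (p * 'X) r) divpD addrC mulKp ?monic_neq0 //; congr (_ + _).
  apply: size1_polyC; rewrite size_divp ?monic_neq0 // leq_subLR addn1.
  rewrite prednK ?size_poly_gt0 ?monic_neq0 // sp size_monic_sub ?monicMr ?monicX //.
  by rewrite size_mulX ?monic_neq0 // sp.
have -> : c *m A = ev (Q 0%N) - b *: c.
  by rewrite Q0 evD evC addrK -[X in ev X]mulr1 evX /ev rmorph1 mulmx1.
rewrite addmx_sub ?eqmx_opp ?scalemx_sub //; last first.
  by rewrite (submx_trans _ (addsmxSl _ _)) ?addsmxSr.
(* For [d = 0] there is no first row, but then [Qr] identifies [ev (Q 0)] with [ev r], which lies in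
   [V0]. *)
have [d0|d0] := posnP d; last first.
  rewrite (submx_trans _ (addsmxSr _ _)) //.
  have <- : row (Ordinal d0) l = ev (Q 0%N) by rewrite rowK.
  exact: row_sub.
move: Qr; rewrite {1}d0 big1 ?addr0 => [->|[j lt] _]; last by exfalso; rewrite d0 in lt.
by rewrite (submx_trans evr) // (submx_trans _ (addsmxSl _ _)) ?addsmxSl.
Qed.

(** [V0] is what an agent receives and [Y] what it can already read off by itself. Adding rows of
    the invariant space [V0] to [l] changes the residual only inside [V0], so they can be chosen to
    make [Y] and the new states recover all of [K], including the received part. *)
Lemma observer_rows (p : {poly F}) (V0 Y : 'M[F]_n) (c : 'rV_n) (d := (size p).-1)
    (K := krylov A V0 c n) :
    p \is monic -> (V0 *m A <= V0)%MS -> (c <= Y)%MS -> (Y <= K)%MS ->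
    (\rank K <= \rank V0 + d.+1)%N -> (\rank K <= \rank Y + d)%N ->
  exists2 l : 'M[F]_(d, n),
    (l *m A - companionmx p *m l <= V0 + c)%MS & (K <= Y + l)%MS.
Proof.
move=> mp V0A cY YK rk rkY; have [l [lF lK Kl]] := observer_rows_krylov mp V0A rk.
have [|S SV0 KS] := @perturb_rows_span _ _ _ Y V0 l.
  apply: leq_trans rkY; apply: mxrankS.
  by rewrite !addsmx_sub YK lK andbT addsmxSl.
exists (l + S).
  rewrite mulmxDl mulmxDr opprD addrACA addmx_sub //.
  rewrite (submx_trans _ (addsmxSl _ _)) // addmx_sub ?eqmx_opp //.
    exact: submx_trans (submxMr _ SV0) V0A.
  by rewrite mulmx_sub.
apply: submx_trans KS; apply: submx_trans Kl _.
rewrite !addsmx_sub addsmxSr andbT.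
rewrite (submx_trans _ (addsmxSl _ _)) ?addsmxSr //=.
by rewrite (submx_trans cY) // (submx_trans _ (addsmxSl _ _)) ?addsmxSl.
Qed.
End ObserverBlock.

(** * Cascades of blocks *)

Section Cascade.
Variables (F : fieldType) (m n : nat) (s : 'I_m -> nat).
Variables (A : 'M[F]_n) (C : forall i : 'I_m, 'M[F]_(s i, n)).
Variable Nb : 'I_m -> {set 'I_m}.
Hypothesis self_neighbor : forall i, i \in Nb i.

(** A diagonal 0/1 mask: rows of agents outside [S] are zeroed rather than removed, so that the size
    stays [N]. *)
Definition select N (ag : 'I_N -> 'I_m) (S : {set 'I_m}) : 'M[F]_N :=
  diag_mx (\row_a (ag a \in S)%:R).

Lemma select_row N (ag : 'I_N -> 'I_m) (S : {set 'I_m}) (L : 'M[F]_(N, n)) a :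
  row a (select ag S *m L) = (ag a \in S)%:R *: row a L.
Proof. by rewrite row_mul row_diag_mx -scalemxAl -rowE mxE. Qed.

Lemma select_subP N (ag : 'I_N -> 'I_m) (S : {set 'I_m}) (L : 'M[F]_(N, n))
    k (X : 'M[F]_(k, n)) :
  reflect (forall a, ag a \in S -> (row a L <= X)%MS) (select ag S *m L <= X)%MS.
Proof.
apply: (iffP row_subP) => [H a aS|H a].
  by have := H a; rewrite select_row aS scale1r.
rewrite select_row; case: (boolP (ag a \in S)) => [/H|] aS; first by rewrite scale1r.
by rewrite scale0r sub0mx.
Qed.

Lemma sub_select N (ag : 'I_N -> 'I_m) (S : {set 'I_m}) (L : 'M[F]_(N, n)) a :
  ag a \in S -> (row a L <= select ag S *m L)%MS.
Proof. by move=> aS; have /select_subP -> := submx_refl (select ag S *m L). Qed.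

Definition outputs (S : {set 'I_m}) : 'M[F]_n := (\sum_(j in S) <<C j>>)%MS.

(* A cascade with characteristic polynomial [p]: the [N] scalar observer states,
   state [a] belonging to agent [ag a], estimate the functionals [L x], and
   [W i] consists of functionals that agent [i] reads off its own states and
   outputs. *)
Definition cascade (p : {poly F}) (W : 'I_m -> 'M[F]_n) : Prop :=
  exists (N : nat) (ag : 'I_N -> 'I_m) (H : 'M[F]_N) (L : 'M[F]_(N, n)),
  [/\ char_poly H = p,
      forall a b, ag b \notin Nb (ag a) -> H a b = 0,
      forall a, (row a (L *m A - H *m L) <= outputs (Nb (ag a)))%MS &
      forall i, (W i <= C i + select ag [set i] *m L)%MS].

Lemma cascade1 : cascade 1 (fun i => <<C i>>%MS).
Proof.
exists 0%N, (fun a : 'I_0 => False_rect _ (notF (ltn_ord a))), 0, 0.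
split=> [|[]|[]|i] //; first by rewrite /char_poly det_mx00.
by rewrite genmxE addsmxSl.
Qed.

Lemma char_poly_lblock N d (H : 'M[F]_N) (G : 'M[F]_(d, N)) (K : 'M[F]_d) :
  char_poly (block_mx H 0 G K) = char_poly H * char_poly K.
Proof.
rewrite /char_poly /char_poly_mx map_block_mx /= map_mx0 scalar_mx_block.
by rewrite opp_block_mx add_block_mx subr0 det_lblock.
Qed.

(** The old states do not see the new ones, so the enlarged matrix is block lower triangular and the
    characteristic polynomials multiply. The residual of the new block is a combination of outputs
    and states of neighbours of [i]; the state part becomes the coupling [G]. *)
Lemma cascade_extend p W W' i d (K : 'M[F]_d) (l : 'M[F]_(d, n)) :
    cascade p W ->
    (l *m A - K *m l <= \sum_(j in Nb i) W j)%MS ->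
    (forall j, j != i -> (W' j <= W j)%MS) -> (W' i <= W i + l)%MS ->
  cascade (p * char_poly K) W'.
Proof.
move=> [N [ag [H [L [<- Hs HL HW]]]]] lK W'j W'i.
have sub : (\sum_(j in Nb i) W j <= outputs (Nb i) + select ag (Nb i) *m L)%MS.
  apply/sumsmx_subP => j jN; apply: submx_trans (HW j) _.
  rewrite addsmx_sub; apply/andP; split.
    by rewrite (submx_trans _ (addsmxSl _ _)) // (sumsmx_sup j) ?genmxE.
  rewrite (submx_trans _ (addsmxSr _ _)) //; apply/select_subP => a.
  by rewrite inE => /eqP aj; apply: sub_select; rewrite aj.
have /sub_addsmxP[[u1 u2] /= lE] := submx_trans lK sub.
(* The mask makes the columns of [G] vanish at states of non-neighbours. *)
pose G := u2 *m select ag (Nb i).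
pose ag' a := match @fintype.split N d a with inl b => ag b | inr _ => i end.
exists (N + d)%N, ag'.
exists (block_mx H 0 G K), (col_mx L l); split.
- exact: char_poly_lblock.
- move=> a b; rewrite !mxE /ag'; case: (fintype.split a) => a';
    rewrite !mxE; case: (fintype.split b) => b'; rewrite ?mxE //.
  + exact: Hs.
  + move=> bi; rewrite big1 // => k _; rewrite !mxE.
    by case: eqP => [->|]; rewrite ?(negbTE bi) ?mulr0n ?mulr0.
  + by rewrite self_neighbor.
- rewrite mul_col_mx mul_block_col mul0mx addr0 opp_col_mx add_col_mx => a.
  rewrite -(splitK a) /ag'; case: (fintype.split a) => a' /=.
    by rewrite (unsplitK (inl a')) rowKu.
  rewrite (unsplitK (inr a')) rowKd opprD addrCA lE -mulmxA.
  by rewrite addrC addrK row_mul submxMl.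
move=> j; have WL : (W j <= C j + select ag' [set j] *m col_mx L l)%MS.
  apply: submx_trans (HW j) (addsmxS (submx_refl _) _).
  apply/select_subP => a aj.
  rewrite -(rowKu a L l); apply: sub_select.
  by rewrite /ag' (unsplitK (inl a)).
have [ji|ji] := eqVneq j i; last exact: submx_trans (W'j _ ji) WL.
rewrite ji in WL *; apply: submx_trans W'i _; rewrite addsmx_sub WL /=.
rewrite (submx_trans _ (addsmxSr _ _)) //; apply/row_subP => a.
by rewrite -(rowKd a L l); apply: sub_select; rewrite /ag' (unsplitK (inr a)) inE.
Qed.
End Cascade.

(** * Even-dimensional designs *)

Section RealFactors.
Variable R : rcfType.

(** A non-real complex root z gives the factor X^2 - 2 Re(z) X + |z|^2: the remainder of [p] modulo
    it is real, of degree at most 1, and vanishes at z, hence is zero. *)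
Lemma monic_root_or_quadratic (p : {poly R}) : (1 < size p)%N ->
  (exists x, root p x) \/
  (exists q : {poly R}, [/\ q \is monic, size q = 3%N & q %| p]).
Proof.
move=> szp; have /closed_rootP[z pz] : size (map_poly (real_complex R) p) != 1%N.
  by rewrite size_map_poly; case: (size p) szp => [|[]].
have [Iz|Iz] := eqVneq (complex.Im z) 0; [left | right].
  exists (complex.Re z); rewrite -(fmorph_root (real_complex R)).
  by case: z pz Iz => x y pz /= y0; rewrite -complexr0 -y0.
have [k kE] : exists k, k = complex.Re z ^+ 2 + complex.Im z ^+ 2 by eexists.
pose t : {poly R} := k%:P - (complex.Re z *+ 2) *: 'X.
have szt : (size t < 3)%N.
  rewrite ltnS (leq_trans (size_polyD _ _)) // geq_max size_polyN.
  rewrite (leq_trans (size_polyC_leq1 _)) //=.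
  by rewrite (leq_trans (size_scale_leq _ _)) ?size_polyX.
pose q := 'X^2 + t.
have szq : size q = 3%N by rewrite size_polyDl size_polyXn.
have mq : q \is monic by rewrite monicE lead_coefDl ?size_polyXn // lead_coefXn.
exists q; split=> //; rewrite /dvdp.
have q0 := monic_neq0 mq.
have szm : (size (p %% q)%R <= 2)%N by rewrite -ltnS -szq ltn_modp.
have qz : (map_poly (real_complex R) q).[z] = 0.
  rewrite /q /t !rmorphD rmorphN /= map_polyZ /= map_polyC map_polyXn map_polyX.
  rewrite !hornerE kE.
  case: (z) => x y /=; apply/eqP; rewrite eq_complex /=; simpc => /=.
  by apply/andP; split; apply/eqP; ring.
have : (map_poly (real_complex R) (p %% q)).[z] = 0.
  move: pz; rewrite /root {1}(divp_eq p q) rmorphD rmorphM /= hornerD hornerM qz.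
  by rewrite mulr0 add0r => /eqP.
have -> : p %% q = (p %% q)`_1 *: 'X + ((p %% q)`_0)%:P.
  apply/polyP => -[|[|j]]; rewrite !coefE ?mulr0 ?mulr1 ?add0r ?addr0 //.
  by rewrite nth_default // (leq_trans szm).
move: (_`_1) (_`_0) => a b; rewrite rmorphD /= map_polyZ /= map_polyC map_polyX !hornerE.
case: (z) Iz => x y /= y0 /eqP; rewrite eq_complex /=; simpc => /= /andP[/eqP ab].
rewrite mulf_eq0 (negbTE y0) orbF => /eqP a0.
by move: ab; rewrite a0 mul0r add0r => ->; rewrite scale0r add0r.
Qed.

Lemma monic_quadratic_factor (p : {poly R}) : p \is monic -> (2 < size p)%N ->
  exists q : {poly R}, [/\ q \is monic, size q = 3%N & q %| p].
Proof.
move=> mp szp; have [|[x /factor_theorem[p1 pE]]|//] := monic_root_or_quadratic (p := p).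
  exact: ltnW.
have mp1 : p1 \is monic by rewrite -(monicMr _ (monicXsubC x)) -pE.
have [|[y /factor_theorem[p2 p1E]]|[q [mq sq qp1]]] := monic_root_or_quadratic (p := p1).
- by move: szp; rewrite pE size_Mmonic ?monic_neq0 ?monicXsubC // size_XsubC addn2.
- exists (('X - y%:P) * ('X - x%:P)); split.
  + by rewrite monicMl monicXsubC.
  + by rewrite size_Mmonic ?monicXsubC ?polyXsubC_eq0 // !size_XsubC.
  + by rewrite pE p1E -mulrA dvdp_mulIr.
by exists q; split=> //; rewrite pE dvdp_mulr.
Qed.

Lemma monic_even_factor (p : {poly R}) d : p \is monic -> ~~ odd d -> (d < size p)%N ->
  exists q r : {poly R}, [/\ q \is monic, r \is monic, size q = d.+1,
    size r = (size p - d)%N & p = r * q].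
Proof.
move=> mp /negbTE od; rewrite -[d](odd_double_half) od add0n => {od}.
elim: d./2 p mp => [|k IHk] p mp szp.
  by exists 1, p; rewrite monic1 size_poly1 double0 subn0 mulr1.
have [|q [mq sq /dvdpP[p1 pE]]] := monic_quadratic_factor mp.
  by apply: leq_ltn_trans szp; rewrite doubleS.
have mp1 : p1 \is monic by rewrite -(monicMr _ mq) -pE.
have szE : size p = (size p1).+2.
  by rewrite pE size_mul ?monic_neq0 // sq addnS /= addn2.
have [|q1 [r [mq1 mr sq1 sr p1E]]] := IHk p1 mp1.
  by move: szp; rewrite szE doubleS !ltnS.
exists (q1 * q), r; split=> //; first by rewrite monicMl.
- by rewrite size_mul ?monic_neq0 // sq sq1 doubleS addn3.
- by rewrite szE doubleS !subSS.
- by rewrite pE p1E mulrA.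
Qed.
End RealFactors.

Lemma leq_half_double k : (k <= k./2.*2.+1)%N.
Proof. by rewrite -{1}(odd_double_half k) -add1n leq_add2r leq_b1. Qed.

Lemma half_double_leq k : (k./2.*2 <= k)%N.
Proof. by rewrite -{2}(odd_double_half k) leq_addl. Qed.

(** The set grows from the root by one vertex at a time: a path from [r] to a vertex still outside
    must cross the boundary along some edge. *)
Lemma connect_set_ind (T : finType) (e : rel T) (r : T) (P : {set T} -> Prop) :
  (forall x, connect e r x) -> P [set r] ->
  (forall (S : {set T}) x y,
     x \in S -> y \notin S -> e x y -> r \in S -> P S -> P (y |: S)) ->
  P [set: T].
Proof.
move=> conn P1 PS.
suff H k : (k < #|T|)%N -> exists2 S : {set T}, (r \in S) && (#|S| == k.+1) & P S.
  have T0 : (0 < #|T|)%N by apply/card_gt0P; exists r.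
  have [|S /andP[_ /eqP cS] PT] := H #|T|.-1; first by rewrite prednK.
  rewrite prednK // in cS; suff <- : S = [set: T] by [].
  by apply/eqP; rewrite eqEcard finset.subsetT cardsT cS /=.
elim: k => [|k IHk] kT; first by exists [set r]; rewrite ?inE ?eqxx ?cards1.
have [|S /andP[rS /eqP cS] PSS] := IHk; first exact: ltnW.
have [z zS] : exists z, z \notin S.
  apply/existsP; rewrite -negb_forall; apply: contraL kT => /forallP H.
  by rewrite -leqNgt -cS -cardsT subset_leq_card //; apply/fintype.subsetP => ? _.
have [x [y [xS yS exy]]] : exists x y, [/\ x \in S, y \notin S & e x y].
  have /connectP[q] := conn z.
  elim: q (r) rS => [|y q IHq] x xS /=; first by move=> _ zx; rewrite zx xS in zS.
  case/andP=> exy qP zq; have [yS|yS] := boolP (y \in S); first exact: (IHq y).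
  by exists x, y.
exists (y |: S); last exact: PS xS yS exy rS PSS.
by rewrite !inE rS orbT cardsU1 yS cS /= add1n.
Qed.

Section Feasible.
Variables (R : rcfType) (m n' : nat) (s : 'I_m -> nat).
Local Notation n := n'.+1.
Variables (A : 'M[R]_n) (C : forall i : 'I_m, 'M[R]_(s i, n)).
Variable Nb : 'I_m -> {set 'I_m}.
Hypothesis self_neighbor : forall i, i \in Nb i.

(* [a i] is the number of observer states charged to agent [i].  The polynomial
   [p] stays arbitrary until the design is complete, so that it can be split
   along the blocks; the parity condition makes this possible over the reals. *)
Definition feasible (a : 'I_m -> nat) (W : 'I_m -> 'M[R]_n) : Prop :=
  [/\ forall i, ~~ odd (a i), forall i, (C i <= W i)%MS &
      forall p, p \is monic -> size p = (\sum_i a i).+1 -> cascade A C Nb p W].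

Definition received (W : 'I_m -> 'M[R]_n) i : 'M[R]_n := (\sum_(j in Nb i) W j)%MS.

Lemma sub_received (W : 'I_m -> 'M[R]_n) i j : j \in Nb i -> (W j <= received W i)%MS.
Proof. by move=> ji; apply: (sumsmx_sup j). Qed.

Lemma feasible0 : feasible (fun=> 0%N) (fun i => <<C i>>%MS).
Proof.
split=> [//|i|p mp]; first by rewrite genmxE.
rewrite big1 // => sp; suff -> : p = 1 by exact: cascade1.
have /size_poly1P[c c0 pE] : size p == 1%N by rewrite sp.
by move: mp; rewrite pE monicE lead_coefC => /eqP ->.
Qed.

(** An arbitrary [p] of the new degree splits as [r * q] with [q] of even degree [d]; [r] goes to
    the old design and [q] to the new companion block. The rows [l] may depend on [q], but [V] may
    not, since [W'] is fixed before [p]. *)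
Lemma feasible_extend a W i d (V : 'M[R]_n) :
    feasible a W -> ~~ odd d ->
    (forall q : {poly R}, q \is monic -> size q = d.+1 ->
      exists2 l : 'M[R]_((size q).-1, n),
        (l *m A - companionmx q *m l <= received W i)%MS & (V <= W i + l)%MS) ->
  exists2 W', feasible (fun j => if j == i then (a i + d)%N else a j) W' &
    (forall j, (W j <= W' j)%MS) /\ (V <= W' i)%MS.
Proof.
move=> [ae CW aW] ed step.
pose W' j := if j == i then (W i + V)%MS else W j.
have WW' j : (W j <= W' j)%MS.
  by rewrite /W'; case: eqP => [->|_]; rewrite ?addsmxSl.
exists W'; last by split=> //; rewrite /W' eqxx addsmxSr.
split=> [j|j|p mp sp].
- by case: eqP => // _; rewrite oddD (negbTE (ae i)) (negbTE ed).
- exact: submx_trans (CW j) (WW' j).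
have {}sp : size p = ((\sum_j a j) + d).+1.
  rewrite sp (bigD1 i) //= [in RHS](bigD1 i) //= eqxx; congr _.+1.
  rewrite -!addnA; congr (_ + _)%N; rewrite addnC; congr (_ + _)%N.
  by apply: eq_bigr => j /negbTE ->.
have [|q [r [mq mr sq sr ->]]] := monic_even_factor mp ed.
  by rewrite sp ltnS leq_addl.
have [l lF lV] := step q mq sq.
rewrite -[q](companionmxK mq).
apply: (cascade_extend self_neighbor (aW r mr _) lF).
- by rewrite sr sp -addSn addnK.
- by move=> j /negbTE ji; rewrite /W' ji.
- by rewrite /W' eqxx addsmx_sub addsmxSl.
Qed.

Lemma feasible_cascade a W p : (0 < m)%N -> feasible a W -> p \is monic ->
  (\sum_i a i < size p)%N -> cascade A C Nb p W.
Proof.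
move=> m0 [ae _ aW] mp sp.
have [|q [r [mq mr sq sr ->]]] := monic_even_factor (d := (\sum_i a i)%N) mp _ sp.
  by elim/big_ind: _ => // x y /negbTE ox /negbTE oy; rewrite oddD ox oy.
(* The leftover factor [r], of either parity, becomes a block tracking the zero functional. *)
rewrite mulrC -[r](companionmxK mr).
apply: (@cascade_extend _ _ _ _ _ _ _ self_neighbor q W W (Ordinal m0) _ _ 0).
- exact: aW.
- by rewrite mul0mx mulmx0 subr0 sub0mx.
- by [].
- exact: addsmxSl.
Qed.

(* Each block is rounded down to even dimension: the possibly missing functional
   is the output row [c] itself, which is measured. *)
Lemma agent_collect a W i (U : 'M[R]_n) :
    feasible a W -> a i = 0%N -> (U *m A <= U)%MS -> (U <= received W i)%MS ->
    C i != 0 ->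
  exists a' W' (V : 'M[R]_n), [/\ feasible a' W', forall j, j != i -> a' j = a j,
    forall j, (W j <= W' j)%MS, (a' i <= \rank V)%N &
    [/\ (V *m A <= V)%MS, (U <= V)%MS, (C i <= V)%MS & (V <= W' i)%MS]].
Proof.
move=> fW ai UA UW Ci0.
have [r0 c0] : exists r, row r (C i) != 0.
  have : ~~ (C i <= (0 : 'M[R]_n))%MS by rewrite submx0.
  by case/row_subPn => r; rewrite submx0; exists r.
suff H k : (k <= s i)%N -> exists a' W' (V : 'M[R]_n),
    [/\ feasible a' W', forall j, j != i -> a' j = a j,
    forall j, (W j <= W' j)%MS, (a' i <= \rank V)%N &
    [/\ (V *m A <= V)%MS, (U <= V)%MS, 
        forall r : 'I_(s i), (r < k)%N -> (row r (C i) <= V)%MS & (V <= W' i)%MS]].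
  have [a' [W' [V [? ? ? ? [? ? CV ?]]]]] := H _ (leqnn _).
  exists a', W', V; split=> //; split=> //; apply/row_subP => r; exact: CV.
elim: k => [_|k IHk kC].
  (* The first block must also store [U], which is received but not yet held by the agent; hence [d]
     is measured against [\rank K] and not against the increment over [U]. The nonzero measured row
     [c] makes up for the dimension lost in rounding. *)
  set c := row r0 (C i) in c0; pose K := krylov A U c n; pose d := ((\rank K)./2).*2.
  have cK : (c <= K)%MS by exact: sub_krylov.
  have rkY : \rank <<c>>%MS = 1%N by rewrite genmxE rank_rV c0.
  have dK : (\rank K <= d.+1)%N by exact: leq_half_double.
  have [|q mq sq|W' fW' [WW' KW']] := feasible_extend (V := K) (i := i) (d := d) fW.
    by rewrite odd_double.
    have cY : (c <= <<c>>)%MS by rewrite genmxE.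
    have YK : (<<c>> <= K)%MS by rewrite genmxE.
    have [||l lF Kl] := observer_rows mq UA cY YK.
    - by rewrite sq (leq_trans dK) ?leq_addl.
    - by rewrite sq rkY add1n.
    exists l.
      apply: submx_trans lF _; rewrite addsmx_sub UW /=.
      apply: submx_trans (sub_received W (self_neighbor i)).
      by case: fW => _ CW _; apply: submx_trans (CW i); apply: row_sub.
    apply: submx_trans Kl _; apply: addsmxS => //; rewrite genmxE.
    by case: fW => _ CW _; apply: submx_trans (CW i); apply: row_sub.
  exists (fun j => if j == i then (a i + d)%N else a j), W', K; split=> //.
  - by move=> j /negbTE ->.
  - by rewrite eqxx ai add0n half_double_leq.
  - by split=> //; [exact: krylov_stable | exact: addsmxSl].
have [a1 [W1 [V [fW1 a1E WW1 a1V [VA UV CV VW]]]]] := IHk (ltnW kC).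
set c := row (Ordinal kC) (C i).
have rows (K : 'M[R]_n) : (V <= K)%MS -> (c <= K)%MS ->
    forall r : 'I_(s i), (r < k.+1)%N -> (row r (C i) <= K)%MS.
  move=> VK cK r; rewrite ltnS leq_eqVlt => /predU1P[rk|rk].
    by rewrite (_ : r = Ordinal kC) //; apply/val_inj.
  exact: submx_trans (CV _ rk) VK.
have [cV|cV] := boolP (c <= V)%MS.
  by exists a1, W1, V; split=> //; split=> //; exact: rows.
(* From now on [V] is held by the agent itself, so only the increment is paid for; [c], being
   outside [V], again covers the rounding. *)
pose K := krylov A V c n; pose d := ((\rank K - \rank V)./2).*2.
have VK : (V <= K)%MS by exact: addsmxSl.
have cK : (c <= K)%MS by exact: sub_krylov.
have cW1 : (c <= W1 i)%MS.
  by case: fW1 => _ CW _; apply: submx_trans (CW i); apply: row_sub.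
have dK : (\rank K <= \rank V + d.+1)%N.
  by rewrite -leq_subLR leq_half_double.
have [|q mq sq|W' fW' [WW' KW']] := feasible_extend (V := K) (i := i) (d := d) fW1.
  - by rewrite odd_double.
  have YK : (V + c <= K)%MS by rewrite addsmx_sub VK.
  have [||l lF Kl] := observer_rows mq VA (addsmxSr V c) YK.
  - by rewrite sq.
  - by rewrite sq; apply: leq_trans dK _; rewrite addnS -addSn leq_add2r rank_adds_row.
  exists l.
    apply: submx_trans lF _; rewrite addsmx_sub.
    by rewrite !(submx_trans _ (sub_received W1 (self_neighbor i))).
  by apply: submx_trans Kl _; apply: addsmxS => //; rewrite addsmx_sub VW.
exists (fun j => if j == i then (a1 i + d)%N else a1 j), W', K; split=> //.
- by move=> j ji; rewrite (negbTE ji) a1E.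
- by move=> j; apply: submx_trans (WW' j).
- rewrite eqxx; apply: leq_trans (leq_add a1V (leqnn d)) _.
  by rewrite -[leqRHS](subnKC (mxrankS VK)) leq_add2l half_double_leq.
- split=> //; [exact: krylov_stable | exact: submx_trans UV VK | exact: rows].
Qed.
End Feasible.

(** * Gathering at a root, then broadcasting *)

Section GatherBroadcast.
Variables (R : rcfType) (m n' : nat) (s : 'I_m -> nat).
Local Notation n := n'.+1.
Variables (A : 'M[R]_n) (C : forall i : 'I_m, 'M[R]_(s i, n)).
Variable Nb : 'I_m -> {set 'I_m}.
Hypothesis self_neighbor : forall i, i \in Nb i.
Hypothesis C_neq0 : forall i, C i != 0.
Hypothesis nb_connected : forall i j, connect (fun y x => (y \in Nb x) && (y != x)) i j.
Hypothesis joint_observability : forall V : 'M[R]_n,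
  (V *m A <= V)%MS -> (forall i, (C i <= V)%MS) -> (1%:M <= V)%MS.
Local Notation feasible := (feasible A C Nb).
Local Notation received := (received Nb).

(* Agents outside [T] have already sent everything they know towards the root
   [r]; [U i] is what agent [i] has received from them. *)
Definition gathering (T : {set 'I_m}) (a : 'I_m -> nat) (W U : 'I_m -> 'M[R]_n) :=
  [/\ feasible a W, forall i, i \in T -> a i = 0%N,
      forall i, (a i <= \rank (W i))%N,
      forall i, (U i *m A <= U i)%MS /\ (U i <= received W i)%MS &
      forall V : 'M[R]_n, (V *m A <= V)%MS ->
        (forall i, i \in T -> (U i <= V)%MS && (C i <= V)%MS) -> (1%:M <= V)%MS].

Lemma received_mono (W W' : 'I_m -> 'M[R]_n) i :
  (forall j, (W j <= W' j)%MS) -> (received W i <= received W' i)%MS.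
Proof.
move=> WW'; apply/sumsmx_subP => j ji.
exact: submx_trans (WW' j) (sub_received _ ji).
Qed.

Lemma gather r : exists a W, [/\ feasible a W,
  forall i, (a i <= \rank (W i))%N & (1%:M <= W r)%MS].
Proof.
(* [P T] says that gathering can be completed once only [T] is left. Growing [T] from the root thus
   runs the gathering backwards: the vertex added last is the leaf that sends first. *)
pose P (T : {set 'I_m}) := forall a W U, gathering T a W U ->
  exists a W, [/\ feasible a W, forall i, (a i <= \rank (W i))%N & (1%:M <= W r)%MS].
suff : P [set: 'I_m].
  move/(_ (fun=> 0%N) (fun i => <<C i>>%MS) (fun=> 0)); apply; split=> //.
  - exact: feasible0.
  - by move=> i; rewrite mul0mx !sub0mx.
  - move=> V VA VC; apply: joint_observability => // i.
    by case/andP: (VC i (finset.in_setT i)).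
pose e := [rel x y | (y \in Nb x) && (y != x)].
have collect (T : {set 'I_m}) a W U i : i \in T -> gathering T a W U ->
  exists a' W' (V : 'M[R]_n), [/\ feasible a' W', forall j, j != i -> a' j = a j,
    forall j, (W j <= W' j)%MS, forall j, (a' j <= \rank (W' j))%N &
    [/\ (V *m A <= V)%MS, (U i <= V)%MS, (C i <= V)%MS & (V <= W' i)%MS]].
  move=> iT [fW aT aW UP VP]; have [UA UW] := UP i.
  have [a' [W' [V [fW' aE WW' aV [VA UV CV VW]]]]] :=
    agent_collect self_neighbor fW (aT i iT) UA UW (C_neq0 i).
  exists a', W', V; split=> // j; have [->|ji] := eqVneq j i.
    exact: leq_trans aV (mxrankS VW).
  by rewrite aE // (leq_trans (aW j)) ?mxrankS.
apply: (@connect_set_ind _ e r).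
- move=> x; have := nb_connected x r.
  by rewrite -[connect e r x]/(connect _ r x) (connect_rev e).
- move=> a W U gW.
  have [|a' [W' [V [fW' aE WW' aV [VA UV CV VW]]]]] := collect _ _ _ _ r _ gW.
    by rewrite inE.
  exists a', W'; split=> //; apply: submx_trans VW.
  case: gW => _ _ _ _; apply=> // i; rewrite inE => /eqP ->.
  by rewrite UV CV.
move=> S w v wS vS /andP[/= vw _] rS IH a W U gW.
have [|a' [W' [V [fW' aE WW' aV [VA UV CV VW]]]]] := collect _ _ _ _ v _ gW.
  by rewrite !inE eqxx.
case: gW => fW aT aW UP VP.
(* [v] leaves the set and hands its space [V] to [w]. As [V] contains [U v] and the rows of [C v],
   the remaining agents still jointly determine the whole state. *)
apply: (IH a' W' (fun j => if j == w then (U w + V)%MS else U j)); split=> //.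
- move=> i iS; rewrite aE ?aT ?inE ?iS ?orbT //.
  by apply: contraNneq vS => <-.
- move=> i; have [UA UW] := UP i; have UW' := submx_trans UW (received_mono i WW').
  case: eqP => [iw|_] //; rewrite -iw; split.
    by rewrite addsmxMr addsmxS.
  by rewrite addsmx_sub UW' iw (submx_trans VW) // sub_received.
- move=> X XA XP; apply: VP => // i.
  have /andP[XU XC] := XP w wS; rewrite eqxx addsmx_sub in XU.
  case/andP: XU => XU XV.
  rewrite !inE => /predU1P[->|iS]; first by rewrite (submx_trans UV) ?(submx_trans CV).
  by have := XP i iS; case: eqP => [->|] //; rewrite XU XC.
Qed.

Lemma broadcast r : exists a W, [/\ feasible a W, (a r <= n)%N,
  forall i, (a i <= n.+1)%N & forall i, (1%:M <= W i)%MS].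
Proof.
pose P (T : {set 'I_m}) := exists a W, [/\ feasible a W, (a r <= n)%N,
  forall i, (a i <= n.+1)%N, forall i, i \notin T -> (a i <= \rank (W i))%N &
  forall i, i \in T -> (1%:M <= W i)%MS].
suff [a [W [fW ar an _ WT]]] : P [set: 'I_m].
  by exists a, W; split=> // i; rewrite WT ?inE.
apply: (@connect_set_ind _ (fun y x => (y \in Nb x) && (y != x)) r) => //.
  have [a [W [fW aW Wr]]] := gather r.
  exists a, W; split=> //; first exact: leq_trans (aW r) (rank_leq_row _).
    by move=> i; rewrite (leq_trans (aW i)) // (leq_trans (rank_leq_row _)).
  by move=> i; rewrite inE => /eqP ->.
move=> S x y xS yS /andP[xy _] rS [a [W [fW ar an aW WS]]].
(* This raises the total of [y] to the even number among [n] and [n.+1]. *)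
pose d := ((n.+1)./2.*2 - a y)%N.
have ayn : (a y <= n)%N by apply: leq_trans (aW y yS) (rank_leq_row _).
have nE : (n <= (n.+1)./2.*2)%N by rewrite -ltnS leq_half_double.
have ed : ~~ odd d.
  by rewrite oddB ?(leq_trans ayn) // odd_double /=; case: fW => /(_ y).
have [|W' fW' [WW' VW']] :=
  feasible_extend self_neighbor (i := y) (V := 1%:M) fW ed.
  move=> q mq sq.
  (* The neighbour [x] already knows the full state, so any rows have an admissible residual; they
     are chosen to complete [W y]. There are enough of them because [a y] is at most the rank of
     [W y]. *)
  have [|l _ lP] := @perturb_rows_span _ _ (size q).-1 (W y) 1%:M 0.
    apply: leq_trans (rank_leq_row _) _; rewrite sq /=.
    by apply: leq_trans nE _; rewrite -leq_subLR leq_sub2l // aW.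
  exists l.
    by apply: submx_trans (submx1 _) (submx_trans (WS x xS) (sub_received W xy)).
  rewrite add0r in lP; apply: submx_trans lP.
  by rewrite (submx_trans _ (addsmxSl _ _)) ?addsmxSr.
exists (fun j => if j == y then (a y + d)%N else a j), W'; split=> //.
- by case: eqP yS => [<-|//]; rewrite rS.
- move=> i; case: eqP => // _; rewrite subnKC ?(leq_trans ayn) //.
  exact: half_double_leq.
- move=> i; rewrite !inE negb_or => /andP[/negbTE -> iS].
  by rewrite (leq_trans (aW i iS)) ?mxrankS.
- move=> i; rewrite !inE => /predU1P[->//|iS].
  exact: submx_trans (WS i iS) (WW' i).
Qed.

Lemma full_cascade (p : {poly R}) : (0 < m)%N -> p \is monic ->
  size p = (m * n + m - 1).+1 ->
  exists2 W, cascade A C Nb p W & forall i, (1%:M <= W i)%MS.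
Proof.
move=> m0 mp sp; pose r := Ordinal m0.
have [a [W [fW ar an W1]]] := broadcast r; exists W => //.
apply: feasible_cascade fW mp _ => //.
rewrite sp ltnS (bigD1 r) //=.
have sumle : (\sum_(i < m | i != r) a i <= m.-1 * n.+1)%N.
  apply: leq_trans (leq_sum _ _) _; first by move=> i _; exact: an i.
  by rewrite sum_nat_const cardC1 card_ord.
apply: leq_trans (leq_add ar sumle) _.
by rewrite mulnS -{2 3}(prednK m0) mulSn addnA addnAC -addnBA // subn1.
Qed.
End GatherBroadcast.

(** * The flow of a linear system *)

Section MatrixExponential.
Local Open Scope classical_set_scope.
Local Open Scope ring_scope.
Variable R : realType.

Lemma norm_mx_entry p q (X : 'M[R]_(p, q)) a b : `|X a b| <= `|X|.
Proof.
by rewrite [leRHS]/Num.Def.normr/= mx_normrE; exact: (le_bigmax _ _ (a, b)).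
Qed.

Lemma norm_mx_le p q (X : 'M[R]_(p, q)) c : 0 <= c ->
  (forall a b, `|X a b| <= c) -> `|X| <= c.
Proof.
move=> c0 Xc; rewrite [leLHS]/Num.Def.normr/= mx_normrE.
by apply: bigmax_le => // -[a b] _; exact: Xc.
Qed.

Lemma is_derive_entry p q (e : R -> 'M[R]_(p, q)) t v a b :
  is_derive t (1 : R) e v -> is_derive t (1 : R) (fun u => e u a b) (v a b).
Proof.
move=> [de <-]; split; first by move/derivable_mxP : de.
by rewrite derive_mx // mxE.
Qed.

(** The bound on [df] is the derivative of the claimed bound [g], so by the mean value theorem
    [g - f] and [g + f] stay nonnegative. *)
Lemma growth_from_derivative (f df : R -> R) (K T : R) k : 0 <= K -> f 0 = 0 ->
    (forall t, is_derive t (1 : R) f (df t)) ->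
    (forall t, 0 <= t <= T -> `|df t| <= K * (t ^+ k / k`!%:R)) ->
  forall t, 0 <= t <= T -> `|f t| <= K * (t ^+ k.+1 / k.+1`!%:R).
Proof.
move=> K0 f0 dfP dfK t /andP[t0 tT].
pose g : {poly R} := (K / k.+1`!%:R) *: 'X^(k.+1).
have gE u : g.[u] = K * (u ^+ k.+1 / k.+1`!%:R).
  by rewrite /g hornerZ hornerXn mulrAC mulrA.
have dgE u : g^`().[u] = K * (u ^+ k / k`!%:R).
  rewrite /g derivZ derivXn hornerZ hornerMn hornerXn /=.
  rewrite factS natrM -(mulr_natr (u ^+ k)).
  have k0 : k.+1%:R != 0 :> R by rewrite pnatr_eq0.
  have kf0 : k`!%:R != 0 :> R by rewrite pnatr_eq0 -lt0n fact_gt0.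
  by move: (k.+1%:R) k0 (k`!%:R) kf0 => a a0 b b0; field; rewrite a0 b0.
have main (h dh : R -> R) : h 0 = 0 -> (forall u, is_derive u (1:R) h (dh u)) ->
    (forall u, 0 <= u <= T -> `|dh u| <= K * (u ^+ k / k`!%:R)) -> h t <= g.[t].
  move=> h0 hP hK.
  have D u : is_derive u (1:R) (horner g - h) (g^`().[u] - dh u).
    exact: is_deriveB.
  have Ct : {within `[0, t], continuous (horner g - h)}.
    by apply: derivable_within_continuous => u _; have [] := D u.
  have [c] := MVT_segment t0 (fun u _ => D u) Ct.
  rewrite in_itv /= => /andP[c0 ct] hE.
  have {hE} : 0 <= (g.[t] - h t) - (g.[0] - h 0).
    rewrite [leRHS]hE mulr_ge0 ?subr_ge0 // dgE.
    by apply: le_trans (ler_norm _) (hK _ _); rewrite c0 (le_trans ct).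
  by rewrite h0 (gE 0) expr0n mul0r mulr0 !subr0 subr_ge0.
rewrite ler_norml -gE; apply/andP; split; last exact: main.
rewrite lerNl; apply: (main (- f) (fun u => - df u)).
- by rewrite -[LHS]/(- f 0) f0 oppr0.
- by move=> u /dfK; rewrite normrN.
Qed.

(** * Solutions of a linear system and the exponential series *)

Section Flow.
Variables (p : nat) (H : 'M[R]_p).

Definition entry_sum : R := \sum_a \sum_b `|H a b|.

Lemma entry_sum_ge0 : 0 <= entry_sum.
Proof. by apply: sumr_ge0 => a _; apply: sumr_ge0. Qed.

Lemma mulmx_entry_le q (X : 'M[R]_(p, q)) K a b : 0 <= K ->
  (forall a b, `|X a b| <= K) -> `|(H *m X) a b| <= entry_sum * K.
Proof.
move=> K0 XK; rewrite mxE (le_trans (ler_norm_sum _ _ _)) //.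
apply: (@le_trans _ _ ((\sum_c `|H a c|) * K)).
  by rewrite mulr_suml ler_sum // => c _; rewrite normrM ler_wpM2l.
rewrite ler_wpM2r // /entry_sum [leRHS](bigD1 a) //= lerDl.
by apply: sumr_ge0 => c _; apply: sumr_ge0.
Qed.

Lemma exp_entry_le k a b : `|(H ^+ k) a b| <= entry_sum ^+ k.
Proof.
elim: k a b => [|k IHk] a b.
  by rewrite !expr0 mxE; case: eqP; rewrite ?normr1 ?normr0.
by rewrite !exprS; apply: mulmx_entry_le => //; rewrite exprn_ge0 ?entry_sum_ge0.
Qed.

Definition expmx_term (t : R) k : 'M[R]_p := (t ^+ k / k`!%:R) *: H ^+ k.

(** Entrywise, the terms are dominated by those of the scalar exponential series at
    [entry_sum * t]. *)
Lemma cvg_expmx_series t : 0 <= t -> cvgn (series (expmx_term t)).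
Proof.
move=> t0; apply/cauchy_cvgP/cauchy_seriesP => eps.
have /cauchy_cvgP/cauchy_seriesP cvgE := is_cvg_series_exp_coeff (entry_sum * t).
have exp0 k : 0 <= exp_coeff (entry_sum * t) k.
  by apply: exp_coeff_ge0; rewrite mulr_ge0 ?entry_sum_ge0.
move=> /cvgE; apply: filterS => -[k1 k2] /=; apply: le_lt_trans.
rewrite (le_trans (ler_norm_sum _ _ _)) // ger0_norm ?sumr_ge0 //.
apply: ler_sum => k _.
have tk : 0 <= t ^+ k / k`!%:R by rewrite divr_ge0 ?exprn_ge0.
apply: norm_mx_le => // a b.
rewrite mxE normrM (ger0_norm tk) /exp_coeff /= exprMn -[leRHS]mulrA [leLHS]mulrC.
by rewrite ler_wpM2r ?exp_entry_le.
Qed.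

Lemma cvg_entry q (u : nat -> 'M[R]_(p, q)) (l : 'M[R]_(p, q)) a b :
  u @ \oo --> l -> (fun k => u k a b) @ \oo --> l a b.
Proof.
move=> ul; apply: (@cvg_comp _ _ _ u (fun M : 'M[R]_(p, q) => M a b) _ _ _ ul).
exact: coord_continuous.
Qed.

Variable e : R -> 'cV[R]_p.
Hypothesis e_ode : forall t, is_derive t (1 : R) e (H *m e t).

Definition taylor k a : {poly R} := \poly_(j < k) ((H ^+ j *m e 0) a 0 / j`!%:R).

Lemma taylorE t k a : (taylor k a).[t] = (series (expmx_term t) k *m e 0) a 0.
Proof.
rewrite /taylor poly_def horner_sum /series /= mulmx_suml summxE big_mkord.
apply: eq_bigr => j _; rewrite hornerZ hornerXn -scalemxAl [RHS]mxE.
by rewrite mulrC mulrA mulrAC.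
Qed.

Lemma deriv_taylor k a t :
  (taylor k.+1 a)^`().[t] = \sum_b H a b * (taylor k b).[t].
Proof.
have -> : (taylor k.+1 a)^`() = \sum_b H a b *: taylor k b.
  apply/polyP => j; rewrite coef_deriv coef_poly coef_sum ltnS.
  under eq_bigr do rewrite coefZ coef_poly.
  case: ltnP => jk; last by rewrite mul0rn big1 // => b _; rewrite mulr0.
  rewrite exprS -[(H * _) *m _]mulmxA mxE mulr_suml -sumrMnl.
  apply: eq_bigr => b _; rewrite factS natrM -[LHS]mulr_natr.
  have j0 : j.+1%:R != 0 :> R by rewrite pnatr_eq0.
  have jf0 : j`!%:R != 0 :> R by rewrite pnatr_eq0 -lt0n fact_gt0.
  by move: (j.+1%:R) j0 (j`!%:R) jf0 => x x0 y y0; field; rewrite x0 y0.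
by rewrite horner_sum; apply: eq_bigr => b _; rewrite hornerZ.
Qed.

Lemma flow_bounded T : 0 <= T ->
  exists2 B, 0 <= B & forall t, 0 <= t <= T -> forall a, `|e t a 0| <= B.
Proof.
move=> T0; have ec t : {for t, continuous (fun u => `|e u|)}.
  apply: (@continuous_comp _ _ _ e (fun x => `|x|)); last exact: norm_continuous.
  apply/differentiable_continuous/derivable1_diffP.
  by have [] := e_ode t.
have [c cT cM] := EVT_max T0 (continuous_subspaceT ec).
exists `|e c| => // t tT a; apply: le_trans (norm_mx_entry _ _ _) _.
by apply: cM; rewrite in_itv.
Qed.

(** The remainder of order k + 1 vanishes at 0 and its derivative is [H] times the remainder of
    order k, so each induction step integrates the previous bound. *)
Lemma taylor_remainder T B : 0 <= B ->
    (forall t, 0 <= t <= T -> forall a, `|e t a 0| <= B) ->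
  forall k t a, 0 <= t <= T ->
    `|e t a 0 - (taylor k a).[t]| <= B * entry_sum ^+ k * (t ^+ k / k`!%:R).
Proof.
move=> B0 eB; elim=> [|k IHk] t a tT.
  by rewrite /taylor poly_def big_ord0 horner0 subr0 !expr0 divr1 !mulr1 eB.
have K0 : 0 <= B * entry_sum ^+ k by rewrite mulr_ge0 ?exprn_ge0 ?entry_sum_ge0.
pose df u := \sum_b H a b * (e u b 0 - (taylor k b).[u]).
apply: (@growth_from_derivative (fun u => e u a 0 - (taylor k.+1 a).[u]) df _ T) => //.
- by rewrite exprS mulrCA mulr_ge0 ?entry_sum_ge0.
- rewrite taylorE /series /= mulmx_suml summxE big_nat_recl //= big1 => [|j _].
    by rewrite /expmx_term !expr0 divr1 scale1r mul1mx addr0 subrr.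
  by rewrite /expmx_term expr0n mul0r scale0r mul0mx mxE.
- move=> u.
  have -> : df u = (H *m e u) a 0 - (taylor k.+1 a)^`().[u].
    rewrite deriv_taylor mxE -sumrB; apply: eq_bigr => b _.
    by rewrite mulrBr.
  have ? := is_derive_entry a 0 (e_ode u).
  exact: is_deriveB.
move=> u uT; have -> : df u = (H *m \col_b (e u b 0 - (taylor k b).[u])) a 0.
  by rewrite mxE; apply: eq_bigr => b _; rewrite mxE.
have u0 : 0 <= u ^+ k / k`!%:R by case/andP: uT => u0 _; rewrite divr_ge0 ?exprn_ge0.
rewrite exprS (mulrCA B) -mulrA; apply: mulmx_entry_le.
  by rewrite mulr_ge0.
by move=> b j; rewrite mxE; apply: IHk.
Qed.

(** The remainder bounds are terms of a convergent exponential series and tend to 0, while the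
    Taylor polynomials are the partial sums of [expmx] applied to [e 0]. *)
Lemma flow_expmx t : 0 <= t -> e t = expmx H t *m e 0.
Proof.
move=> t0; apply/colP => a.
have [B B0 eB] := flow_bounded t0.
have c1 : (fun k => (taylor k a).[t]) @ \oo --> e t a 0.
  apply/subr_cvg0; apply/norm_cvg0P.
  apply: (@squeeze_cvgr _ _ _ _ (cst 0) (fun k => B * exp_coeff (entry_sum * t) k)).
  - apply: nearW => k; rewrite normr_ge0 /= distrC.
    have := taylor_remainder B0 eB k a (t := t); rewrite t0 lexx => /(_ isT).
    by rewrite /exp_coeff /= exprMn !mulrA.
  - exact: cvg_cst.
  - by rewrite -[0](mulr0 B); apply: cvgMl_tmp; exact: cvg_exp_coeff.
have c2 : (fun k => (taylor k a).[t]) @ \oo --> (expmx H t *m e 0) a 0.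
  under eq_fun do rewrite taylorE mxE.
  rewrite mxE; apply: cvg_big => [|b _]; first exact: add_continuous.
  apply: cvgMr_tmp.
  exact: cvg_entry (cvg_expmx_series t0).
exact: cvg_unique c1 c2.
Qed.
End Flow.

Lemma mulmx3_norm_le p q r (X : 'M[R]_(q, p)) (v : 'M[R]_(p, r)) :
  exists c, forall Y : 'M[R]_p, `|X *m Y *m v| <= c * `|Y|.
Proof.
pose c := (\sum_a \sum_b `|X a b|) * (\sum_a \sum_b `|v a b|).
have X0 : 0 <= \sum_a \sum_b `|X a b| by apply: sumr_ge0 => a _; apply: sumr_ge0.
have v0 : 0 <= \sum_a \sum_b `|v a b| by apply: sumr_ge0 => a _; apply: sumr_ge0.
exists c => Y; apply: norm_mx_le => [|a b]; first by rewrite mulr_ge0 ?mulr_ge0.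
rewrite mxE (le_trans (ler_norm_sum _ _ _)) //.
apply: (@le_trans _ _ (\sum_j (\sum_a \sum_b `|X a b|) * `|Y| * \sum_b `|v j b|)).
  apply: ler_sum => j _; rewrite normrM ler_pM //; last first.
    by rewrite [leRHS](bigD1 b) //= lerDl sumr_ge0.
  rewrite mxE (le_trans (ler_norm_sum _ _ _)) //.
  apply: (@le_trans _ _ ((\sum_i `|X a i|) * `|Y|)).
    by rewrite mulr_suml ler_sum // => i _; rewrite normrM ler_wpM2l // norm_mx_entry.
  rewrite ler_wpM2r // [leRHS](bigD1 a) //= lerDl.
  by apply: sumr_ge0 => i _; apply: sumr_ge0.
by rewrite -mulr_sumr /c mulrAC.
Qed.
End MatrixExponential.

(** * From cascades to distributed observers *)

(** An injection between index sets of equal size is a permutation, and conjugation by its matrix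
    preserves the determinant. *)
Lemma char_poly_mxsub (F : comNzRingType) p q (f : 'I_p -> 'I_q) (H : 'M[F]_q) :
  p = q -> injective f -> char_poly (mxsub f f H) = char_poly H.
Proof.
move=> pq; case: q / pq f H => f H finj.
pose g := perm finj.
rewrite /char_poly.
have -> : char_poly_mx (mxsub f f H) = perm_mx g *m char_poly_mx H *m (perm_mx g)^T.
  rewrite tr_perm_mx -row_permE -col_permE; apply/matrixP => i j.
  by rewrite !mxE !permE (inj_eq finj).
by rewrite !det_mulmx det_tr det_perm mulrAC -signr_addb addbb mul1r.
Qed.

(** Conjugation permutes the linear factors, so it fixes every coefficient of the product. *)
Lemma real_poly_of_symmetric (R : realType) (L : seq R[i]) : conj_symmetric L ->
  exists P : {poly R}, [/\ P \is monic, size P = (size L).+1 &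
    map_poly (real_complex R) P = \prod_(l <- L) ('X - l%:P)].
Proof.
move=> symL; set Q := \prod_(l <- L) _.
have QJ : map_poly (@conjc R) Q = Q.
  rewrite /Q rmorph_prod /=.
  under eq_bigr do rewrite rmorphB /= map_polyX map_polyC /=.
  by rewrite -[LHS](big_map (@conjc R) xpredT (fun l => 'X - l%:P)); apply: perm_big.
have ImQ k : complex.Im Q`_k = 0.
  have := congr1 (fun q : {poly R[i]} => q`_k) QJ; rewrite coef_map /=.
  case: (Q`_k) => x y [] /eqP; rewrite eq_sym -addr_eq0 -mulr2n mulrn_eq0 /= => /eqP.
  by [].
pose P := \poly_(k < size Q) complex.Re Q`_k.
have PQ : map_poly (real_complex R) P = Q.
  apply/polyP => k; rewrite coef_map coef_poly.
  case: ltnP => kQ; last by rewrite nth_default.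
  by have := ImQ k; case: (Q`_k) => x y /= ->.
exists P; split=> //.
- by rewrite -(map_monic (real_complex R)) PQ monic_prod_XsubC.
- by rewrite -(size_map_poly (real_complex R)) PQ size_prod_XsubC.
Qed.

(** This is observability in the form used for gathering: an invariant space containing all output
    rows contains every row of the observability matrix. *)
Lemma observable_stable_full (R : realType) m n (s : 'I_m -> nat) (A : 'M[R]_n)
    (C : forall i, 'M[R]_(s i, n)) (V : 'M[R]_n) :
  observable (\mxcol_(i < m) C i) A ->
  (V *m A <= V)%MS -> (forall i, (C i <= V)%MS) -> (1%:M <= V)%MS.
Proof.
rewrite /observable => obs VA CV.
apply: (submx_trans (B := obs_matrix (\mxcol_(i < m) C i) A)).
  by rewrite sub1mx /row_full obs.
have CV' : (\mxcol_(i < m) C i <= V)%MS.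
  by apply/row_subP => a; rewrite row_mxcol; apply: submx_trans (row_sub _ _) (CV _).
apply/row_subP => a; rewrite row_mxcol; apply: submx_trans (row_sub _ _) _.
elim: (nat_of_ord _) => [|k IHk]; first by rewrite expr0 mulmx1.
by rewrite exprSr mulmxA; apply: submx_trans (submxMr _ IHk) VA.
Qed.

Section Derivatives.
Variable R : realType.

Lemma is_derive_mx p q (e : R -> 'M[R]_(p, q)) t (v : 'M[R]_(p, q)) :
  (forall a b, is_derive t (1 : R) (fun u => e u a b) (v a b)) ->
  is_derive t (1 : R) e v.
Proof.
move=> ev; have de : derivable e t 1.
  by apply/derivable_mxP => a b; have [] := ev a b.
split=> //; rewrite derive_mx //; apply/matrixP => a b; rewrite mxE.
by have [] := ev a b.
Qed.

Lemma is_derive_mulmx k p q (B : 'M[R]_(k, p)) (e : R -> 'M[R]_(p, q)) t v :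
  is_derive t (1 : R) e v -> is_derive t (1 : R) (fun u => B *m e u) (B *m v).
Proof.
move=> ev; apply: is_derive_mx => a b; rewrite mxE.
have -> : (fun u => (B *m e u) a b) = \sum_j (B a j \*: (fun u => e u j b)).
  by apply/funext => u; rewrite mxE fct_sumE.
have ? j := is_derive_entry j b ev.
exact: is_derive_sum.
Qed.
End Derivatives.

(** * Regrouping the scalar states by agent *)

Section Blocks.
Variables (m N : nat) (ag : 'I_N -> 'I_m).

Definition owned i : {set 'I_N} := [set a | ag a == i].
Definition state_index i (u : 'I_#|owned i|) : 'I_N := enum_val u.

Lemma ag_state_index i u : ag (@state_index i u) = i.
Proof. by have := enum_valP u; rewrite inE => /eqP. Qed.

Lemma state_index_inj (p q : {i : 'I_m & 'I_#|owned i|}) :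
  state_index (tagged p) = state_index (tagged q) -> p = q.
Proof.
case: p q => [i u] [j v] /= e.
have ij : i = j by rewrite -(ag_state_index u) e ag_state_index.
by case: j / ij v e => v /enum_val_inj ->.
Qed.

Lemma sum_owned (V : nmodType) (f : 'I_N -> V) :
  \sum_b f b = \sum_j \sum_(v < #|owned j|) f (state_index v).
Proof.
rewrite (partition_big ag xpredT) //=; apply: eq_bigr => j _.
by rewrite -(big_enum_val f); apply: eq_bigl => b; rewrite inE.
Qed.

Lemma sum_card_owned : (\sum_j #|owned j| = N)%N.
Proof.
have := sum_owned (fun=> 1%N); rewrite sum1_card card_ord => e; rewrite [RHS]e.
by apply: eq_bigr => j _; rewrite sum1_card card_ord.
Qed.

Lemma char_poly_blocks (F : comNzRingType) (H : 'M[F]_N) :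
  char_poly (\mxblock_(i < m, j < m) mxsub (@state_index i) (@state_index j) H) =
  char_poly H.
Proof.
pose f (a : 'I_(\sum_j #|owned j|)) := state_index (tagged (tagnat.sig a)).
rewrite -(char_poly_mxsub (f := f)) //; last 1 first.
- by move=> a b /state_index_inj /(can_inj tagnat.sigK).
- congr char_poly; apply/matrixP => a b; rewrite !mxE //.
exact: sum_card_owned.
Qed.
End Blocks.

(** * Reading off the observer matrices *)

Section Realization.
Variables (R : realType) (m n : nat) (s : 'I_m -> nat).
Variables (A : 'M[R]_n) (C : forall i : 'I_m, 'M[R]_(s i, n)).
Variable Nb : 'I_m -> {set 'I_m}.

Lemma sub_outputs (S : {set 'I_m}) (v : 'rV[R]_n) : (v <= outputs C S)%MS ->
  exists k : forall j, 'rV[R]_(s j), v = \sum_(j in S) k j *m C j.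
Proof.
case/sub_sumsmxP => u ->.
exists (fun j => u j *m (<<C j>>%MS *m pinvmx (C j))).
by apply: eq_bigr => j _; rewrite -mulmxA mulmxKpV ?genmxE.
Qed.

(** Here [L i] collects the functionals tracked by agent [i]. The fourth clause makes the errors
    [z - L x] autonomous, and the last one recovers the state from the agent's own states and
    output. *)
Lemma observer_of_cascade p W :
    cascade A C Nb p W -> (forall i, (1%:M <= W i)%MS) ->
  exists (ni : 'I_m -> nat)
         (H : forall i j : 'I_m, 'M[R]_(ni i, ni j))
         (K : forall i j : 'I_m, 'M[R]_(ni i, s j))
         (M : forall i : 'I_m, 'M[R]_(n, ni i))
         (N : forall i : 'I_m, 'M[R]_(n, s i))
         (L : forall i : 'I_m, 'M[R]_(ni i, n)),
    [/\ (\sum_i ni i).+1 = size p,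
        (forall i j, j \notin Nb i -> H i j = 0 /\ K i j = 0),
        char_poly (\mxblock_(i < m, j < m) H i j) = p,
        (forall i, \sum_(j in Nb i) (H i j *m L j + K i j *m C j) = L i *m A) &
        forall i, M i *m L i + N i *m C i = 1%:M].
Proof.
move=> [N [ag [H [L [<- Hs HL HW]]]]] W1.
have [k kP] := choice (fun a => sub_outputs (HL a)).
pose st i := @state_index m N ag i.
have MN i : exists X : 'M[R]_(n, s i) * 'M[R]_(n, #|owned ag i|),
    X.2 *m rowsub (st i) L + X.1 *m C i = 1%:M.
  have : (1%:M <= C i + rowsub (st i) L)%MS.
    apply: submx_trans (W1 i) (submx_trans (HW i) _).
    apply: addsmxS => //; apply/select_subP => a; rewrite inE => ai.
    have aO : a \in owned ag i by rewrite inE.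
    rewrite -(enum_rankK_in aO aO) -[X in (X <= _)%MS](row_rowsub (st i)).
    exact: row_sub.
  by case/sub_addsmxP => [[u1 u2] /= ->]; exists (u1, u2); rewrite addrC.
pose X i := sval (cid (MN i)); have XP i := svalP (cid (MN i)).
exists (fun i => #|owned ag i|).
exists (fun i j => mxsub (st i) (st j) H).
exists (fun i j => if j \in Nb i then \matrix_u k (st i u) j else 0).
exists (fun i => (X i).2), (fun i => (X i).1), (fun i => rowsub (st i) L).
split.
- by rewrite sum_card_owned size_char_poly.
- move=> i j /negbTE ji; rewrite ji; split=> //.
  by apply/matrixP => u v; rewrite !mxE Hs // !ag_state_index ji.
- exact: char_poly_blocks.
- move=> i; apply/row_matrixP => u.
  have := kP (st i u); rewrite ag_state_index linearB /= => /eqP.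
  rewrite subr_eq => /eqP E.
  rewrite row_mul row_rowsub -row_mul E addrC linear_sum /=.
  under eq_bigr do rewrite linearD /=.
  rewrite big_split /=; congr (_ + _); last first.
    by apply: eq_bigr => j ji; rewrite ji row_mul rowK.
  rewrite row_mul mulmx_sum_row (sum_owned ag) big_mkcond /=; apply: eq_bigr => j _.
  case: ifPn => ji; last first.
    by rewrite big1 // => v _; rewrite mxE Hs ?scale0r // !ag_state_index.
  rewrite row_mul mulmx_sum_row; apply: eq_bigr => v _.
  by rewrite row_rowsub !mxE.
- exact: XP.
Qed.
End Realization.

Theorem theorem1 (R : realType) (m n : nat) (s : 'I_m -> nat)
    (A : 'M[R]_n) (C : forall i : 'I_m, 'M[R]_(s i, n))
    (Nb : 'I_m -> {set 'I_m}) :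
  (0 < m)%N -> (0 < n)%N ->
  (forall i, C i != 0) ->
  observable (\mxcol_(i < m) C i) A ->
  (forall i, i \in Nb i) ->
  strongly_connected Nb ->
  forall L : seq R[i], size L = (m * n + m - 1)%N -> conj_symmetric L ->
  exists (ni : 'I_m -> nat)
         (H : forall i j : 'I_m, 'M[R]_(ni i, ni j))
         (K : forall i j : 'I_m, 'M[R]_(ni i, s j))
         (M : forall i j : 'I_m, 'M[R]_(n, ni j))
         (N : forall i j : 'I_m, 'M[R]_(n, s j)),
    [/\ (\sum_(i < m) ni i)%N = (m * n + m - 1)%N,
        (forall i j, j \notin Nb i ->
           [/\ H i j = 0, K i j = 0, M i j = 0 & N i j = 0]),
        spectrum_eq (\mxblock_(i < m, j < m) H i j) L
      & forall (x : R -> 'cV[R]_n) (z : forall i : 'I_m, R -> 'cV[R]_(ni i)),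
          (forall t : R, is_derive t (1 : R) x (A *m x t)) ->
          (forall (i : 'I_m) (t : R), is_derive t (1 : R) (z i)
             (\sum_(j in Nb i) (H i j *m z j t + K i j *m (C j *m x t)))) ->
          forall i : 'I_m, exists c : R, forall t : R, 0 <= t ->
            `| \sum_(j in Nb i) (M i j *m z j t + N i j *m (C j *m x t)) - x t |
              <= c * `| expmx (\mxblock_(i < m, j < m) H i j) t |].
Proof.
move=> m0; case: n A C => // n' {}A {}C _ C0 obs self_nb conn L sL symL.
have [p [mp sp pL]] := real_poly_of_symmetric symL.
have [W cW W1] := full_cascade self_nb C0 conn
  (fun V => observable_stable_full (V := V) obs) m0 mp (etrans sp (congr1 S sL)).
have [ni [H [K [M [N [Z [sni HK0 pH HZ MZ]]]]]]] :=
  observer_of_cascade cW W1.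
(* The estimates are read off without neighbours, so the output matrices are block diagonal. *)
exists ni, H, K, (fun i j => if i == j then M j else 0),
  (fun i j => if i == j then N j else 0).
split.
- by apply: succn_inj; rewrite sni sp sL.
- move=> i j ji; have [-> ->] := HK0 i j ji.
  by have /negbTE -> : i != j by apply: contraNneq ji => <-.
- by rewrite /spectrum_eq -map_char_poly pH.
move=> x z xP zP i.
pose err j t := z j t - Z j *m x t.
have errP j t : is_derive t (1 : R) (err j) (\sum_k H j k *m err k t).
  have -> : \sum_k H j k *m err k t =
      \sum_(k in Nb j) (H j k *m z k t + K j k *m (C k *m x t)) - Z j *m (A *m x t).
    rewrite mulmxA -HZ mulmx_suml -sumrB [RHS]big_mkcond; apply: eq_bigr => k _.
    case: ifPn => kj; last by have [-> _] := HK0 j k kj; rewrite mul0mx.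
    by rewrite mulmxDl opprD addrACA !mulmxA subrr addr0 mulmxBr mulmxA.
  have ? := zP j t; have ? := is_derive_mulmx (Z j) (xP t).
  exact: is_deriveB.
pose e t := \mxcol_(j < m) err j t.
have eP t : is_derive t (1 : R) e ((\mxblock_(i < m, j < m) H i j) *m e t).
  rewrite mul_mxblock_mxrow; apply: is_derive_mx => a b; rewrite mxE.
  have -> : (fun u => e u a b) = (fun u => err (tagnat.sig1 a) u (tagnat.sig2 a) b).
    by apply/funext => u; rewrite mxE.
  exact: is_derive_entry (errP _ t).
(* The row selection extracts the block of agent [i] from the stacked error; the estimation error is
   [M i] times that block. *)
have [c cP] := mulmx3_norm_le (M i *m rowsub (tagnat.Rank i) 1%:M) (e 0).
exists c => t t0.
suff -> : \sum_(j in Nb i) ((if i == j then M j else 0) *m z j t +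
    (if i == j then N j else 0) *m (C j *m x t)) - x t =
    M i *m rowsub (tagnat.Rank i) 1%:M *m expmx (\mxblock_(i < m, j < m) H i j) t *m e 0.
  exact: cP.
rewrite -mulmxA -(flow_expmx eP t0) -mulmxA mul_rowsub_mx mul1mx.
have -> : rowsub (tagnat.Rank i) (e t) = err i t by exact: mxcolK.
rewrite (bigD1 i) ?self_nb //= eqxx big1 => [|j /andP[_ /negbTE ji]]; last first.
  by rewrite eq_sym ji !mul0mx addr0.
rewrite addr0 -{2}[x t]mul1mx -(MZ i) mulmxDl opprD addrACA !mulmxA subrr addr0.
by rewrite mulmxBr mulmxA.
Qed.
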